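(* Let $\Omega\subset\mathbb R^2$ be a periodic rectangle with a conforming Cartesian rectangular mesh $\mathcal T_h$; let $p\ge1$, $m\in\{p-1,p\}$, $\gamma>1$, $\tau>0$. Let $\rho_h\in V_h^p$ have positive nodal values and let $\eta_h\in V_h^0$, $\eta_h\ge0$; both are held fixed. Let $Y^n=(e_h^n,\boldsymbol u_h^n,\boldsymbol B_h^n)\in V_h^p\times X_h^p\times\mathcal B_h^m$ with $e^n_{h,q}>0$ at every node, and let $Y^{(1)},Y^{(2)},Y^{(3)}=Y^{n+1}$ be given by the stabilized SSP-RK(3,3) magnetic–velocity update $$\begin{aligned} Y^{(1)}&=\mathcal P_M^\tau\bigl(Y^n+\tau\mathcal L_M(Y^n;\rho_h,\eta_h)\bigr),\\ Y^{(2)}&=\mathcal P_M^\tau\bigl(\tfrac34Y^n+\tfrac14[Y^{(1)}+\tau\mathcal L_M(Y^{(1)};\rho_h,\eta_h)]\bigr),\\ Y^{n+1}&=\mathcal P_M^\tau\bigl(\tfrac13Y^n+\tfrac23[Y^{(2)}+\tau\mathcal L_M(Y^{(2)};\rho_h,\eta_h)]\bigr). \end{aligned}$$ Then at every stage $i$ and every node $q$, $e_{h,q}^{(i)}\ge e_{h,q}^n>0$, and $$\mathcal E_{\mathrm{ent},h}^{n+1}\le\mathcal E_{\mathrm{ent},h}^n ,$$ where $\mathcal E_{\mathrm{ent},h}=-\frac1{\gamma-1}(\rho_hs_h,1)_{V,h}$ with $s_{h,q}=\log\bigl((\gamma-1)\rho_{h,q}e_{h,q}\bigr)-\gamma\log\rho_{h,q}$.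 Thus the stabilized magnetic–velocity update is entropy stable and preserves positive nodal internal energy.
   Context: **Nodes.** Each $K\in\mathcal T_h$ is an axis-parallel rectangle with side lengths $h_{x,K},h_{y,K}$, image of $[-1,1]^2$ under an affine map; $J_K=h_{x,K}h_{y,K}/4$. The nodes $x_q\in K$ are the $(p+1)^2$ tensor-product Gauss–Lobatto–Legendre (GLL) points, with weights $M_q^K=J_K\omega_i\omega_j$ for $q=(i,j)$, $\omega_i$ the $(p+1)$-point GLL weights on $[-1,1]$. $(f,g)_{V,h}=\sum_K\sum_{x_q\in K}M_q^K f_qg_q$ with values taken from inside $K$ (also applied to products of several functions). **Spaces** (periodic; $\mathbb Q^{a,b}(K)$: degree $\le a$ in $x$, $\le b$ in $y$; $\mathbb Q^k=\mathbb Q^{k,k}$). $V_h^k=\{v\in L^2(\Omega):v|_K\in\mathbb Q^k(K)\}$; $W_h^{k+1}=\{w\in H^1(\Omega):w|_K\in\mathbb Q^{k+1}(K)\}$; $N_h^k=\{\boldsymbol g\in H(\mathrm{curl};\Omega):\boldsymbol g|_K\in\mathbb Q^{k,k+1}\times\mathbb Q^{k+1,k}\}$; $R_h^k=\{\boldsymbol r\in H(\mathrm{div};\Omega):\boldsymbol r|_K\in\mathbb Q^{k+1,k}\times\mathbb Q^{k,k+1}\}$. $X_h^p=(V_h^p)^3$, $\mathcal B_h^m=R_h^m\times V_h^m$, $\mathcal A_h^m=N_h^m\times W_h^{m+1}$ (in-plane, out-of-plane components). $\nabla\times\boldsymbol a=(\partial_ya_z,-\partial_xa_z,\partial_xa_y-\partial_ya_x)^T$,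 which maps $\mathcal A_h^m$ into $\mathcal B_h^m$. **Operator $\mathcal L_M$.** For $Y=(e_h,\boldsymbol u_h,\boldsymbol B_h)$, $\mathcal L_M(Y;\rho_h,\eta_h)=(\dot e_h,\dot{\boldsymbol u}_h,\dot{\boldsymbol B}_h)$ is defined as follows. First $\boldsymbol J_h,\boldsymbol E_h\in\mathcal A_h^m$ are determined by $(\boldsymbol J_h,\boldsymbol\chi_h)_{\mathcal A,h}=(\boldsymbol B_h,\nabla\times\boldsymbol\chi_h)_{\mathcal B,h}$ and $(\boldsymbol E_h,\boldsymbol G_h)_{\mathcal A,h}=\mathcal C_h(\boldsymbol u_h,\boldsymbol B_h;\boldsymbol G_h)+(\eta_h\boldsymbol J_h\cdot\boldsymbol G_h,1)_{V,h}$ for all $\boldsymbol\chi_h,\boldsymbol G_h\in\mathcal A_h^m$. Then $(\rho_h\dot e_h,v_h)_{V,h}=(\eta_h|\boldsymbol J_h|^2,v_h)_{V,h}$ for all $v_h\in V_h^p$; $(\rho_h\dot{\boldsymbol u}_h,\boldsymbol v_h)_{X,h}=\mathcal C_h(\boldsymbol v_h,\boldsymbol B_h;\boldsymbol J_h)$ for all $\boldsymbol v_h\in X_h^p$; $\dot{\boldsymbol B}_h=-\nabla\times\boldsymbol E_h$. Here $(\rho_h\boldsymbol v,\boldsymbol z)_{X,h}=\sum_d(\rho_hv_d,z_d)_{V,h}$; $(\cdot,\cdot)_{\mathcal B,h}$ is the $L^2(\Omega)$ product on $\mathcal B_h^m$ (realized by exact quadrature); $(\boldsymbol F,\boldsymbol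 G)_{\mathcal A,h}$ is the elementwise tensor quadrature of $F_xG_x+F_yG_y+F_zG_z$ using, with the $(m+1)$-point Gauss–Legendre rule G and the $(m+2)$-point GLL rule L, G in $x$ and L in $y$ for the $x$-component, L in $x$ and G in $y$ for the $y$-component, and L in both for the $z$-component; $\mathcal C_h(\boldsymbol v,\boldsymbol B;\boldsymbol G)=(-\boldsymbol v\times\boldsymbol B,\boldsymbol G)_{\mathcal A,h}$. **Stage map $\mathcal P_M^\tau$.** $\mathcal P_M^\tau(e_h^-,\boldsymbol u_h^-,\boldsymbol B_h)=(e_h^+,\boldsymbol u_h^+,\boldsymbol B_h)$ is either the identity (velocity oscillation elimination disabled) or the following map. With $(\boldsymbol v,\boldsymbol z)_{\rho,K}=\sum_{x_q\in K}M_q^K\rho_q\boldsymbol v_q\cdot\boldsymbol z_q$, let $P^\rho_{\ell,K}$ be the corresponding orthogonal projection of $[\mathbb Q^p(K)]^3$ onto $[\mathbb Q^\ell(K)]^3$, $P^\rho_{-1,K}=0$, $\boldsymbol w_{\ell,K}=(P^\rho_{\ell,K}-P^\rho_{\ell-1,K})\boldsymbol u_h^-$. At each node of $K$, $$\boldsymbol u_{h,q}^+=(\boldsymbol w_{0,K})_q+\sum_{\ell=1}^p\mathcal D_{\ell,K}(\boldsymbol w_{\ell,K})_q,\qquad e_q^+=e_q^-+\tfrac12\sum_{\ell=1}^p[1-\mathcal D_{\ell,K}^2]|(\boldsymbol w_{\ell,K})_q|^2,$$ $\mathcal D_{\ell,K}=\exp[-s_M\tau\Theta_{\ell,K}]$,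 $s_M\ge0$, $\Theta_{\ell,K}=\sum_{I\in\{x,y\}}\lambda_{M,I,K}\sum_{r=0}^\ell\sigma^u_{r,I,K}$, where, for $\boldsymbol u_h=\boldsymbol u_h^-$: $\lambda_{M,I,K}=\frac{2p+1}{h_{I,K}}\max_{x_q\in K}\bigl(|u_{I,h}(x_q)|+|\boldsymbol B_h(x_q)|/\sqrt{\rho_h(x_q)}\bigr)$; $\sigma^u_{r,I,K}=\max_{d\in\{x,y,z\}}\frac{(2r+1)h_{I,K}^r}{2\,r!}\frac{J_{r,I,K}(u_{d,h})}{\Delta^u_{I,K}}$ (a component constant to roundoff contributes zero, in particular when the denominator vanishes); $J_{r,I,K}(w)=\sum_F\bigl(\frac1{|F|}\int_F[\![\partial_I^rw]\!]^2ds\bigr)^{1/2}$ over the two faces $F$ of $K$ normal to direction $I$, $[\![\cdot]\!]$ the jump; $\Delta^u_{I,K}=\max_d\Delta_{I,K}(u_{d,h})$, $\Delta_{I,K}(w)=\max\{\max_{K'\in\mathcal X_{I,K}}\|w-\overline w_{I,K}\|_{L^\infty(K')},10^{-6}\|w-\overline w_\Omega\|_{L^\infty(\Omega)}\}$, with $\mathcal X_{I,K}$ the row/column of elements through $K$ in direction $I$, $\overline w_{I,K}$ the mean of $w$ over it and $\overline w_\Omega$ the mean over $\Omega$. *)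

(* Defs.v *)
From mathcomp Require Import all_boot all_order all_algebra polyXY.
From mathcomp Require Import all_classical all_reals all_analysis.

Set Implicit Arguments.
Unset Strict Implicit.
Unset Printing Implicit Defensive.

Import Order.TTheory GRing.Theory Num.Theory.
Import numFieldNormedType.Exports.

Local Open Scope classical_set_scope.
Local Open Scope ring_scope.

(** * Vectors with three components *)

Definition vec3 (T : Type) := 'I_3 -> T.
Definition ix : 'I_3 := @Ordinal 3 0 isT.
Definition iy : 'I_3 := @Ordinal 3 1 isT.
Definition iz : 'I_3 := @Ordinal 3 2 isT.
Definition mk3 (T : Type) (a b c : T) : vec3 T := fun d => nth a [:: a; b; c] d.

Definition dot3 (R : pzRingType) (a b : vec3 R) : R := \sum_(d < 3) a d * b d.
Definition norm3 (R : realType) (a : vec3 R) : R := Num.sqrt (dot3 a a).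

(** * One-dimensional quadrature on [[-1, 1]] *)

Record qrule (R : realType) (n : nat) :=
  QRule { qnode : 'I_n -> R; qwgt : 'I_n -> R }.

Definition q_exact (R : realType) n (g : qrule R n) (k : nat) : Prop :=
  forall f : {poly R}, (size f <= k)%N ->
    \sum_(i < n) qwgt g i * f.[qnode g i]
    = (\int[lebesgue_measure]_(t in `[(-1 : R), 1]) f.[t])%R.

Definition q_increasing (R : realType) n (g : qrule R n) : Prop :=
  forall i j : 'I_n, (i < j)%N -> qnode g i < qnode g j.

(* The n-point Gauss-Legendre rule: exact for all degrees <= 2n-1. *)
Definition gauss_legendre (R : realType) n (g : qrule R n) : Prop :=
  q_increasing g /\ q_exact g n.*2.

(* The n-point Gauss-Lobatto-Legendre rule (n >= 2): both endpoints are nodes,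
   and the rule is exact for all degrees <= 2n-3. *)
Definition gauss_lobatto (R : realType) n (g : qrule R n) : Prop :=
  [/\ q_increasing g,
      forall i : 'I_n, i = 0%N :> nat -> qnode g i = -1,
      forall i : 'I_n, i = n.-1 :> nat -> qnode g i = 1
    & q_exact g (n.*2 - 2)].

(** * Periodic Cartesian meshes *)

(* The period cell is [gx 0, gx ncx] x [gy 0, gy ncy]; the values of the grid
   functions beyond ncx and ncy are irrelevant. Spacings may vary. *)
Record mesh (R : realType) := Mesh {
  ncx : nat; ncy : nat;
  gx : nat -> R; gy : nat -> R;
  ncx_gt0 : (0 < ncx)%N; ncy_gt0 : (0 < ncy)%N;
  gx_lt : forall i, (i < ncx)%N -> gx i < gx i.+1;
  gy_lt : forall j, (j < ncy)%N -> gy j < gy j.+1 }.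

Definition cell (R : realType) (M : mesh R) : Type := ('I_(ncx M) * 'I_(ncy M))%type.

Inductive dir := DX | DY.

Section Mesh.
Variables (R : realType) (M : mesh R).
Implicit Types K : cell M.

Definition hsize (I : dir) K : R :=
  match I with
  | DX => gx M K.1.+1 - gx M K.1
  | DY => gy M K.2.+1 - gy M K.2
  end.

Definition jac K : R := hsize DX K * hsize DY K / 4.

Definition ref_pt K (s t : R) : R * R :=
  (gx M K.1 + hsize DX K * (s + 1) / 2, gy M K.2 + hsize DY K * (t + 1) / 2).

(* Half-open, so that the cells partition the period cell. *)
Definition cell_set K : set (R * R) :=
  [set z | gx M K.1 <= z.1 < gx M K.1.+1 /\ gy M K.2 <= z.2 < gy M K.2.+1].

Definition Omega : set (R * R) :=
  [set z | gx M 0%N <= z.1 < gx M (ncx M) /\ gy M 0%N <= z.2 < gy M (ncy M)].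

Definition leb2 : {measure set (measurableTypeR R * measurableTypeR R) -> \bar R} :=
  (lebesgue_measure \x lebesgue_measure)%E.

Definition int2 (S : set (R * R)) (f : R * R -> R) : R :=
  (\int[leb2]_(z in S) f z)%R.

Definition mean (S : set (R * R)) (f : R * R -> R) : R := int2 S f / fine (leb2 S).

Definition Linf (S : set (R * R)) (f : R * R -> R) : R :=
  fine ('N[leb2]_+oo[(EFin \o f) \_ S])%E.

End Mesh.

(** * Piecewise polynomial functions

    An element of a broken polynomial subspace of L^2 is given by its restriction to
    each cell, a polynomial in the physical coordinates. In [{poly {poly R}}] the outer
    variable is x and the inner one is y. *)

Definition bpoly (R : realType) (M : mesh R) : Type := cell M -> {poly {poly R}}.

Section Spaces.
Variables (R : realType) (M : mesh R).
Implicit Types (K : cell M) (v w : bpoly M) (a b : vec3 (bpoly M)).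

Definition ev (f : {poly {poly R}}) (z : R * R) : R := f.[z.1, z.2].

Definition bval v (z : R * R) : R := \sum_(K : cell M) \1_(cell_set K) z * ev (v K) z.

Definition pdx (n : nat) (f : {poly {poly R}}) : {poly {poly R}} := f^`(n).
Definition pdy (n : nat) (f : {poly {poly R}}) : {poly {poly R}} :=
  map_poly (fun g : {poly R} => g^`(n)) f.
Definition pd (I : dir) : nat -> {poly {poly R}} -> {poly {poly R}} :=
  match I with DX => pdx | DY => pdy end.

Definition Qdeg (i j : nat) (f : {poly {poly R}}) : Prop :=
  (size f <= i.+1)%N /\ (sizeY f <= j.+1)%N.

(** ** Sobolev conformity on the torus *)

(* [D i j] is the partial derivative d_x^i d_y^j of the smooth periodic function
   [D 0 0]. *)
Definition periodic_test (D : nat -> nat -> R * R -> R) : Prop :=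
  [/\ forall i j, continuous (D i j),
      forall i j x y, is_derive x (1 : R) (fun t : R => D i j (t, y)) (D i.+1 j (x, y)),
      forall i j x y, is_derive y (1 : R) (fun t : R => D i j (x, t)) (D i j.+1 (x, y)),
      forall x y, D 0%N 0%N (x + (gx M (ncx M) - gx M 0%N), y) = D 0%N 0%N (x, y)
    & forall x y, D 0%N 0%N (x, y + (gy M (ncy M) - gy M 0%N)) = D 0%N 0%N (x, y)].

Definition inL2 (g : R * R -> R) : Prop :=
  measurable_fun (Omega M : set (measurableTypeR R * measurableTypeR R)) g /\
  (leb2 R).-integrable (Omega M) (fun z => (g z ^+ 2)%:E).

Let ipO (f g : R * R -> R) : R := int2 (Omega M) (fun z => f z * g z).

(* Piecewise polynomials are in L^2, so only the weak derivatives are constrained. *)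
Definition inH1 w : Prop :=
  exists g1 g2 : R * R -> R, [/\ inL2 g1, inL2 g2 &
    forall D, periodic_test D ->
      ipO (bval w) (D 1%N 0%N) = - ipO g1 (D 0%N 0%N) /\
      ipO (bval w) (D 0%N 1%N) = - ipO g2 (D 0%N 0%N)].

Definition inHdiv v w : Prop :=
  exists2 g : R * R -> R, inL2 g &
    forall D, periodic_test D ->
      ipO (bval v) (D 1%N 0%N) + ipO (bval w) (D 0%N 1%N) = - ipO g (D 0%N 0%N).

(* The scalar curl of (v, w) is d_x w - d_y v. *)
Definition inHcurl v w : Prop :=
  exists2 g : R * R -> R, inL2 g &
    forall D, periodic_test D ->
      ipO (bval w) (D 1%N 0%N) - ipO (bval v) (D 0%N 1%N) = - ipO g (D 0%N 0%N).

(** ** Finite element spaces *)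

Definition Vh (k : nat) v : Prop := forall K, Qdeg k k (v K).

Definition Wh (k : nat) w : Prop := inH1 w /\ Vh k w.

Definition Nh (k : nat) v w : Prop :=
  inHcurl v w /\ forall K, Qdeg k k.+1 (v K) /\ Qdeg k.+1 k (w K).

Definition Rh (k : nat) v w : Prop :=
  inHdiv v w /\ forall K, Qdeg k.+1 k (v K) /\ Qdeg k k.+1 (w K).

Definition Xh (p : nat) a : Prop := forall d, Vh p (a d).
Definition Bh (m : nat) a : Prop := Rh m (a ix) (a iy) /\ Vh m (a iz).
Definition Ah (m : nat) a : Prop := Nh m (a ix) (a iy) /\ Wh m.+1 (a iz).

Definition curl a : vec3 (bpoly M) :=
  mk3 (fun K => pdy 1 (a iz K))
      (fun K => - pdx 1 (a iz K))
      (fun K => pdx 1 (a iy K) - pdy 1 (a ix K)).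

Definition cross a b : vec3 (bpoly M) :=
  mk3 (fun K => a iy K * b iz K - a iz K * b iy K)
      (fun K => a iz K * b ix K - a ix K * b iz K)
      (fun K => a ix K * b iy K - a iy K * b ix K).

Definition vopp a : vec3 (bpoly M) := fun d K => - a d K.

(** ** Discrete inner products *)

(* Tensor rule with [g1] in x and [g2] in y, applied cell by cell. *)
Definition quad2 (n1 n2 : nat) (g1 : qrule R n1) (g2 : qrule R n2) v : R :=
  \sum_(K : cell M) \sum_(i < n1) \sum_(j < n2)
    jac K * qwgt g1 i * qwgt g2 j * ev (v K) (ref_pt K (qnode g1 i) (qnode g2 j)).

Definition ipA (m : nat) (gG : qrule R m.+1) (gL : qrule R m.+2) a b : R :=
  quad2 gG gL (fun K => a ix K * b ix K)
  + quad2 gL gG (fun K => a iy K * b iy K)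
  + quad2 gL gL (fun K => a iz K * b iz K).

Definition ipB a b : R :=
  int2 (Omega M) (fun z => \sum_(d < 3) bval (a d) z * bval (b d) z).

Definition Ch (m : nat) (gG : qrule R m.+1) (gL : qrule R m.+2)
    (v B G : vec3 (bpoly M)) : R :=
  ipA gG gL (vopp (cross v B)) G.

End Spaces.

(** * Nodal values *)

Section Nodal.
Variables (R : realType) (M : mesh R) (p : nat) (g : qrule R p.+1).
Implicit Types (K : cell M) (v w rho : bpoly M) (a : vec3 (bpoly M)).

Definition node : Type := ('I_p.+1 * 'I_p.+1)%type.

Definition node_pt K (q : node) : R * R := ref_pt K (qnode g q.1) (qnode g q.2).

Definition evq K (f : {poly {poly R}}) (q : node) : R := ev f (node_pt K q).

Definition val_at v K (q : node) : R := evq K (v K) q.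
Definition vec_at a K (q : node) : vec3 R := fun d => val_at (a d) K q.

Definition mass K (q : node) : R := jac K * qwgt g q.1 * qwgt g q.2.

Definition sumV (f : cell M -> node -> R) : R :=
  \sum_(K : cell M) \sum_(q : node) mass K q * f K q.

Definition Eent (gamma : R) rho (e : bpoly M) : R :=
  - (gamma - 1)^-1 * sumV (fun K q =>
      val_at rho K q *
      (ln ((gamma - 1) * val_at rho K q * val_at e K q)
       - gamma * ln (val_at rho K q))).

End Nodal.

(** * States *)

Record state (R : realType) (M : mesh R) :=
  State { se : bpoly M; su : vec3 (bpoly M); sB : vec3 (bpoly M) }.

(* The linear combination c1 Y1 + c2 Y2; [c%:P%:P] is the constant polynomial c. *)
Definition comb (R : realType) (M : mesh R) (c1 : R) (Y1 : state M) (c2 : R)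
    (Y2 : state M) : state M :=
  State (fun K => c1%:P%:P * se Y1 K + c2%:P%:P * se Y2 K)
        (fun d K => c1%:P%:P * su Y1 d K + c2%:P%:P * su Y2 d K)
        (fun d K => c1%:P%:P * sB Y1 d K + c2%:P%:P * sB Y2 d K).

(** * The magnetic-velocity operator

    [LM_rel ... Y Z] says that Z is the value of the operator at Y. *)

Definition LM_rel (R : realType) (M : mesh R) (p m : nat) (g : qrule R p.+1)
    (gG : qrule R m.+1) (gL : qrule R m.+2) (rho eta : bpoly M)
    (Y Z : state M) : Prop :=
  exists J E : vec3 (bpoly M),
    [/\ Ah m J
        /\ (forall chi, Ah m chi -> ipA gG gL J chi = ipB (sB Y) (curl chi)),
        Ah m E
        /\ (forall G, Ah m G ->
              ipA gG gL E G
              = Ch gG gL (su Y) (sB Y) G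
                + sumV g (fun K q =>
                    val_at g eta K q * dot3 (vec_at g J K q) (vec_at g G K q))),
        Vh p (se Z)
        /\ (forall v, Vh p v ->
              sumV g (fun K q =>
                val_at g rho K q * val_at g (se Z) K q * val_at g v K q)
              = sumV g (fun K q =>
                  val_at g eta K q * norm3 (vec_at g J K q) ^+ 2 * val_at g v K q)),
        Xh p (su Z)
        /\ (forall v, Xh p v ->
              \sum_(d < 3) sumV g (fun K q =>
                val_at g rho K q * val_at g (su Z d) K q * val_at g (v d) K q)
              = Ch gG gL v (sB Y) J)
      & sB Z = vopp (curl E)].

(** * The velocity oscillation elimination *)

Section Oscillation.
Variables (R : realType) (M : mesh R).
Implicit Types (K : cell M) (w : bpoly M) (u : vec3 (bpoly M)).

(* Row (I = DX) or column (I = DY) of cells through K. *)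
Definition line (I : dir) K : {set cell M} :=
  match I with
  | DX => [set K' : cell M | K'.2 == K.2]%SET
  | DY => [set K' : cell M | K'.1 == K.1]%SET
  end.

Definition line_set (I : dir) K : set (R * R) :=
  [set z | exists2 K', K' \in line I K & cell_set K' z].

Definition Delta (I : dir) K w : R :=
  Num.max
    (\big[Num.max/0]_(K' in line I K)
       Linf (cell_set K') (fun z => bval w z - mean (line_set I K) (bval w)))
    (10 ^- 6 * Linf (Omega M) (fun z => bval w z - mean (Omega M) (bval w))).

Definition Deltau (I : dir) K u : R := \big[Num.max/0]_(d < 3) Delta I K (u d).

(* Jumps of d_I^r w across the lower and upper face of K normal to I, at tangential
   coordinate t. Neighbours are cyclic, and each side is evaluated at its own copy of
   the face, which matters across the periodic boundary. *)
Definition jump_lo (I : dir) (r : nat) w K (t : R) : R :=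
  match I with
  | DX => ev (pd DX r (w K)) (gx M K.1, t)
          - ev (pd DX r (w (ord_pred K.1, K.2))) (gx M (ord_pred K.1).+1, t)
  | DY => ev (pd DY r (w K)) (t, gy M K.2)
          - ev (pd DY r (w (K.1, ord_pred K.2))) (t, gy M (ord_pred K.2).+1)
  end.

Definition jump_hi (I : dir) (r : nat) w K (t : R) : R :=
  match I with
  | DX => ev (pd DX r (w (ordS K.1, K.2))) (gx M (ordS K.1), t)
          - ev (pd DX r (w K)) (gx M K.1.+1, t)
  | DY => ev (pd DY r (w (K.1, ordS K.2))) (t, gy M (ordS K.2))
          - ev (pd DY r (w K)) (t, gy M K.2.+1)
  end.

(* Tangential extent of the faces of K normal to I. *)
Definition face (I : dir) K : set R :=
  match I with
  | DX => `[gy M K.2, gy M K.2.+1]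
  | DY => `[gx M K.1, gx M K.1.+1]
  end.

Definition face_len (I : dir) K : R :=
  match I with DX => hsize DY K | DY => hsize DX K end.

Definition face_rms (I : dir) K (f : R -> R) : R :=
  Num.sqrt ((face_len I K)^-1 *
            (\int[lebesgue_measure]_(t in face I K) (f t ^+ 2))%R).

Definition Jjump (r : nat) (I : dir) K w : R :=
  face_rms I K (jump_lo I r w K) + face_rms I K (jump_hi I r w K).

(* [rc I K w] is the test "w is constant to roundoff"; flagged components contribute
   zero. *)
Definition sigma (rc : dir -> cell M -> bpoly M -> bool) (r : nat) (I : dir) K u : R :=
  \big[Num.max/0]_(d < 3)
    (if rc I K (u d) then 0
     else (2 * r + 1)%N%:R * hsize I K ^+ r / (2 * r`!%:R)
          * (Jjump r I K (u d) / Deltau I K u)).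

(* An admissible roundoff test flags at least the exactly constant components, those
   with vanishing deviation, hence all components when the denominator is zero. *)
Definition roundoff_test (rc : dir -> cell M -> bpoly M -> bool) : Prop :=
  forall I K w, Delta I K w = 0 -> rc I K w.

Variables (p : nat) (g : qrule R p.+1) (rho : bpoly M).

Definition dir_comp (I : dir) : 'I_3 := match I with DX => ix | DY => iy end.

Definition lambda (I : dir) K (u B : vec3 (bpoly M)) : R :=
  (2 * p + 1)%N%:R / hsize I K *
  \big[Num.max/0]_(q : node p)
    (`|val_at g (u (dir_comp I)) K q|
     + norm3 (vec_at g B K q) / Num.sqrt (val_at g rho K q)).

Definition Theta (rc : dir -> cell M -> bpoly M -> bool) (l : nat) K
    (u B : vec3 (bpoly M)) : R :=
  \sum_(I <- [:: DX; DY]) lambda I K u B * \sum_(0 <= r < l.+1) sigma rc r I K u.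

Definition damp (rc : dir -> cell M -> bpoly M -> bool) (sM tau : R) (l : nat) K
    (u B : vec3 (bpoly M)) : R :=
  expR (- (sM * tau * Theta rc l K u B)).

Definition ip_rho K (v z : vec3 {poly {poly R}}) : R :=
  \sum_(q : node p) mass g K q * val_at g rho K q
    * dot3 (fun d => evq g K (v d) q) (fun d => evq g K (z d) q).

(* w is the orthogonal projection of v onto [Q^l(K)]^3. *)
Definition is_proj (l : nat) K (v w : vec3 {poly {poly R}}) : Prop :=
  (forall d, Qdeg l l (w d)) /\
  (forall z : vec3 {poly {poly R}}, (forall d, Qdeg l l (z d)) ->
     ip_rho K (fun d => v d - w d) z = 0).

(* With [P l K] the projection of degree l, and P_{-1} = 0. *)
Definition increment (P : nat -> cell M -> vec3 {poly {poly R}}) (l : nat) K :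
    vec3 {poly {poly R}} :=
  fun d => P l K d - (if l is l'.+1 then P l' K d else 0).

(* [PM_rel ... Y Z] says that Z is the value of the stage map at Y; [voe] tells whether
   the velocity oscillation elimination is enabled. *)
Definition PM_rel (voe : bool) (rc : dir -> cell M -> bpoly M -> bool) (sM tau : R)
    (Y Z : state M) : Prop :=
  if voe then
    exists P : nat -> cell M -> vec3 {poly {poly R}},
      let w l K q : vec3 R := fun d => evq g K (increment P l K d) q in
      let D l K := damp rc sM tau l K (su Y) (sB Y) in
      [/\ forall l K, (l <= p)%N -> is_proj l K (fun d => su Y d K) (P l K),
          Xh p (su Z)
          /\ (forall K q d, val_at g (su Z d) K q
                = w 0%N K q d + \sum_(1 <= l < p.+1) D l K * w l K q d),
          Vh p (se Z)
          /\ (forall K q, val_at g (se Z) K q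
                = val_at g (se Y) K q
                  + 2^-1 * \sum_(1 <= l < p.+1)
                             (1 - D l K ^+ 2) * norm3 (w l K q) ^+ 2)
        & sB Z = sB Y]
  else Z = Y.

End Oscillation.

(* Main.v *)
Require Import Defs.
From mathcomp Require Import all_boot all_order all_algebra polyXY lra zify.
From mathcomp Require Import all_classical all_reals all_analysis measurable_realfun.
Set Implicit Arguments.
Unset Strict Implicit.
Unset Printing Implicit Defensive.

Import Order.TTheory GRing.Theory Num.Theory.
Import numFieldNormedType.Exports.
Local Open Scope classical_set_scope.
Local Open Scope ring_scope.

(** Gauss-Lobatto weights are positive, so testing the energy equation with nodal delta
    functions turns it into the pointwise identity rho e' = eta |J|^2 >= 0: a forward
    Euler step cannot decrease a nodal internal energy. Neither can the stage map, since
    the damping factors lie in [0, 1], and the SSP-RK stages are convex combinations of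
    forward Euler steps. With rho fixed, the mathematical entropy is a decreasing
    function of every nodal energy. *)

(** * Strict positivity of integrals of nonnegative polynomials *)

Lemma finite_root (R : idomainType) (f : {poly R}) :
  f != 0 -> finite_set [set t | root f t].
Proof.
(* An infinite root set would contain at least [size f] distinct roots, one more than the degree
   allows. *)
move=> f0; apply: contrapT => /(infinite_set_fset (size f))[B sub].
rewrite leqNgt => /negP; apply; apply: max_poly_roots => //.
  by apply/allP => t tB; exact: sub.
exact: finmap.fset_uniq.
Qed.

(** If the integral were zero, [f] would vanish almost everywhere on the interval. The interval
    would then be covered by a null set and the finitely many roots of [f], against its positive
    length [b - a]. *)
Lemma Rintegral_poly_gt0 (R : realType) (a b : R) (f : {poly R}) :
  a < b -> f != 0 -> (forall t, a <= t <= b -> 0 <= f.[t]) ->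
  0 < (\int[lebesgue_measure]_(t in `[a, b]) f.[t])%R.
Proof.
move=> ab f0 fge0; set D := `[a, b]%classic.
have mf : measurable_fun (D : set (measurableTypeR R)) (fun t => (f.[t])%:E).
  apply/measurable_EFinP/measurable_funTS.
  by apply: continuous_measurable_fun; exact: continuous_horner.
have fin : (@lebesgue_measure R).-integrable D (EFin \o horner f).
  apply: continuous_compact_integrable; first exact: segment_compact.
  by apply: continuous_subspaceT; exact: continuous_horner.
have Dge0 t : D t -> (0 <= (f.[t])%:E)%E.
  by rewrite /D /= in_itv /= lee_fin; exact: fge0.
rewrite /Rintegral fine_gt0// lt_neqAle eq_sym.
rewrite -andbA; apply/and3P; split; last first.
- rewrite -ge0_fin_numE ?integral_ge0//; apply: integrable_fin_num fin.
  exact: measurable_itv.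
- by apply: integral_ge0 => t; exact: Dge0.
apply/negP => /eqP int0.
have [N [mN N0 sub]] : ae_eq lebesgue_measure D (fun t => (f.[t])%:E) (cst 0%E).
  apply: (iffLR (ae_eq_integral_abs lebesgue_measure (measurable_itv _) mf)).
  rewrite -[RHS]int0.
  by apply: eq_integral => t; rewrite inE => Dt; rewrite gee0_abs ?Dge0.
have Z0 : lebesgue_measure [set t | root f t] = 0%E.
  by apply/countable_lebesgue_measure0/finite_set_countable/finite_root.
have mZ : measurable ([set t | root f t] : set (measurableTypeR R)).
  apply: countable_measurable => [t|]; first exact: measurable_set1.
  exact/finite_set_countable/finite_root.
have : (lebesgue_measure D <= 0)%E.
  have <- : lebesgue_measure (N `|` [set t | root f t]) = 0%E.
    by rewrite measureU0.
  apply: le_measure; rewrite ?inE; [exact: measurable_itv|exact: measurableU|].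
  move=> t Dt; have [ft|nft] := boolP (root f t); [by right|left].
  apply: sub => /= /(_ Dt) [] /eqP; exact/negP.
by rewrite lebesgue_measure_itv /= lte_fin ab -EFinB lee_fin; lra.
Qed.

(** * Positivity of the Gauss-Lobatto weights *)

Lemma q_increasing_ltr (R : realType) n (g : qrule R n) (i j : 'I_n) :
  q_increasing g -> (qnode g i < qnode g j) = (i < j)%N.
Proof.
move=> ginc; case: (ltngtP i j) => [/ginc//|/ginc ji|/val_inj ->].
- by apply/negbTE; rewrite -leNgt ltW.
- by rewrite ltxx.
Qed.

Lemma q_increasing_inj (R : realType) n (g : qrule R n) :
  q_increasing g -> injective (qnode g).
Proof.
move=> ginc i j gij; apply/val_inj => /=.
by case: (ltngtP i j) => // /ginc; rewrite gij ltxx.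
Qed.

(** For such an [f] the quadrature sum has the single term [qwgt g i * f.[qnode g i]]. By exactness
    it equals the integral of a nonzero nonnegative polynomial. *)
Lemma q_exact_wgt_gt0 (R : realType) n (g : qrule R n) k (i : 'I_n) (f : {poly R}) :
  q_exact g k -> (size f <= k)%N -> f.[qnode g i] != 0 ->
  (forall j, j != i -> f.[qnode g j] = 0) ->
  (forall t, -1 <= t <= 1 -> 0 <= f.[t]) -> -1 <= qnode g i <= 1 ->
  0 < qwgt g i.
Proof.
move=> gex szf fi0 fj0 fge0 gi.
have fi_gt0 : 0 < f.[qnode g i] by rewrite lt_neqAle eq_sym fi0 fge0.
have f0 : f != 0 by apply: contra_neq fi0 => ->; rewrite horner0.
have := @Rintegral_poly_gt0 R (-1) 1 f ltac:(lra) f0 fge0.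
rewrite -(gex f szf) (bigD1 i)//= big1 ?addr0 => [|j /fj0 ->]; last by rewrite mulr0.
by rewrite pmulr_lgt0.
Qed.

(* [(t - x)^2], except that the factor is linear at an endpoint of [-1, 1], where it
   cannot change sign. *)
Definition nonneg_factor (R : realType) (x : R) : {poly R} :=
  if x == -1 then 'X + 1 else if x == 1 then 1 - 'X else ('X - x%:P) ^+ 2.

Lemma nonneg_factor_ge0 (R : realType) (x t : R) :
  -1 <= t <= 1 -> 0 <= (nonneg_factor x).[t].
Proof.
rewrite /nonneg_factor => t1; case: eqP => _; last case: eqP => _; rewrite !hornerE.
- by lra.
- by lra.
- exact: sqr_ge0.
Qed.

Lemma nonneg_factor_eq0 (R : realType) (x t : R) :
  ((nonneg_factor x).[t] == 0) = (t == x).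
Proof.
rewrite /nonneg_factor.
have [->|_] := eqVneq x (-1); last have [->|_] := eqVneq x 1; rewrite !hornerE.
- by rewrite addr_eq0.
- by rewrite subr_eq0 eq_sym.
- by rewrite sqrf_eq0 subr_eq0.
Qed.

Lemma size_nonneg_factor (R : realType) (x : R) :
  size (nonneg_factor x) = (3 - (x == -1)%R - (x == 1)%R)%N.
Proof.
have ne : (-1 == 1 :> R) = false by apply: lt_eqF; lra.
rewrite /nonneg_factor; have [->|_] := eqVneq x (-1); last have [_|_] := eqVneq x 1.
- by rewrite ne /= -polyC1 size_XaddC.
- by rewrite -size_polyN opprB -polyC1 size_XsubC.
- by rewrite size_exp_XsubC.
Qed.

Section GaussLobatto.
Variables (R : realType) (p : nat) (g : qrule R p.+1).
Hypotheses (p_gt0 : (0 < p)%N) (gll : gauss_lobatto g).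

Lemma gauss_lobatto_node_itv i : -1 <= qnode g i <= 1.
Proof.
have [ginc g0 g1 _] := gll.
rewrite -{1}(g0 ord0)// -(g1 ord_max)// !leNgt !q_increasing_ltr//= -leqNgt.
exact: leq_ord.
Qed.

(** The test polynomial is the product of [nonneg_factor] over all other nodes. The linear factors
    at the endpoints keep its degree at 2p-2 for an interior [i] and 2p-1 for an endpoint, within
    the exactness of the rule; squares throughout would give degree 2p. *)
Lemma gauss_lobatto_wgt_gt0 i : 0 < qwgt g i.
Proof.
have [ginc g0 g1 gex] := gll.
pose F j := nonneg_factor (qnode g j); pose f := \prod_(j | j != i) F j.
have F0 j : F j != 0.
  by rewrite -size_poly_gt0 size_nonneg_factor; case: eqP; case: eqP.
apply: (@q_exact_wgt_gt0 _ _ _ _ _ f gex).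
- rewrite /f size_prod// cardC1 card_ord /=.
  have sF j : size (F j) = (3 - (j == ord0) - (j == ord_max))%N.
    rewrite size_nonneg_factor -(g0 ord0)// -(g1 ord_max)//.
    by rewrite !(inj_eq (q_increasing_inj ginc)).
  have sum1 (k : 'I_p.+1) : (\sum_j (j == k) = 1)%N.
    by rewrite (bigD1 k)//= eqxx big1 // => j /negbTE ->.
  (* The indicators are added rather than subtracted, so that the sum splits without truncated
     subtraction. Since [p > 0], the nodes [ord0] and [ord_max] differ and no node is counted as
     both endpoints. *)
  have : (\sum_j (size (F j) + (j == ord0) + (j == ord_max)) = \sum_(j < p.+1) 3)%N.
    apply: eq_bigr => j _; rewrite sF; case: eqP => [->|_]; last by case: eqP.
    by rewrite -val_eqE /= eq_sym gtn_eqF.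
  rewrite !big_split /= !sum1 sum_nat_const card_ord => sumF.
  have sFi : (2 <= size (F i))%N.
    rewrite sF; case: eqP => [->|_]; last by case: eqP.
    by rewrite -val_eqE /= eq_sym gtn_eqF.
  move: sumF sFi; rewrite (bigD1 i)//=.
  by move: (size (F i)) (\sum_(j | j != i) _)%N => s S; clear; lia.
- by rewrite /f horner_prod prodf_seq_neq0; apply/allP => j _; apply/implyP => ji;
    rewrite nonneg_factor_eq0 (inj_eq (q_increasing_inj ginc)) eq_sym.
- move=> j ji; rewrite /f horner_prod (bigD1 j)//=.
  by have /eqP -> : (F j).[qnode g j] == 0 by [rewrite nonneg_factor_eq0]; rewrite mul0r.
- by move=> t t1; rewrite /f horner_prod; apply: prodr_ge0 => j _; exact: nonneg_factor_ge0.
- exact: gauss_lobatto_node_itv.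
Qed.

End GaussLobatto.

(** * Tensor-product polynomials and nodal delta functions *)

Lemma Qdeg_tensor (R : realType) i j (a b : {poly R}) :
  (size a <= i.+1)%N -> (size b <= j.+1)%N -> Qdeg i j (map_poly polyC a * b%:P).
Proof.
have szM (c d : {poly R}) : (size (map_poly polyC c * d%:P)%R <= size c)%N.
  rewrite (leq_trans (size_polyMleq _ _))// size_map_polyC size_polyC.
  by case: (d != 0); rewrite /= ?addn1// addn0 leq_pred.
move=> sa sb; split; first exact: leq_trans (szM _ _) sa.
(* Exchanging the two variables reduces the degree in y to the bound [szM] on the outer degree. *)
rewrite sizeYE rmorphM /= swapXY_map_polyC swapXY_polyC mulrC.
exact: leq_trans (szM _ _) sb.
Qed.

Lemma ev_tensor (R : realType) (a b : {poly R}) z :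
  ev (map_poly polyC a * b%:P) z = a.[z.1] * b.[z.2].
Proof. by rewrite /ev hornerM hornerC horner_map hornerM hornerC. Qed.

Lemma Qdeg0_ev (R : realType) (f : {poly {poly R}}) z1 z2 :
  Qdeg 0 0 f -> ev f z1 = ev f z2.
Proof.
move=> [/size1_polyC f1 f2].
have /size1_polyC f00 : (size (f`_0)%R <= 1)%N by apply: leq_trans (max_size_coefXY _ _) f2.
by rewrite /ev f1 f00 !hornerC.
Qed.

Section NodalValues.
Variables (R : realType) (M : mesh R) (p : nat) (g : qrule R p.+1).
Implicit Types (K : cell M) (q : node p) (v w rho : bpoly M).

Lemma hsize_gt0 I K : 0 < hsize I K.
Proof. by case: I; rewrite subr_gt0 (gx_lt, gy_lt). Qed.

Lemma jac_gt0 K : 0 < jac K.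
Proof. by rewrite /jac divr_gt0// mulr_gt0// hsize_gt0. Qed.

(** A product of unnormalized Lagrange polynomials, one in x and one in y. A nonzero value at [q]
    suffices, since it is cancelled when the polynomial is used as a test function. *)
Lemma nodal_delta K q : q_increasing g ->
  exists f : {poly {poly R}}, [/\ Qdeg p p f, evq g K f q != 0
    & forall q', q' != q -> evq g K f q' = 0].
Proof.
move=> ginc.
pose x i := gx M K.1 + hsize DX K * (qnode g i + 1) / 2.
pose y i := gy M K.2 + hsize DY K * (qnode g i + 1) / 2.
(* The affine map onto a cell stretches by a positive factor, so distinct reference nodes stay
   distinct. *)
have inj c I : injective (fun i => c + hsize I K * (qnode g i + 1) / 2).
  move=> i j /addrI /(mulIf _) /(mulfI _) /addIr.
  by rewrite invr_eq0 pnatr_eq0 gt_eqF ?hsize_gt0// => /(_ isT isT)/q_increasing_inj ->.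
pose l (z : 'I_p.+1 -> R) k := \prod_(i | i != k) ('X - (z i)%:P).
have szl z k : (size (l z k) <= p.+1)%N.
  rewrite size_prod => [|i _]; last by rewrite polyXsubC_eq0.
  under eq_bigr do rewrite size_XsubC.
  by rewrite sum_nat_const cardC1 card_ord /=; lia.
have lE z k i : injective z -> ((l z k).[z i] == 0) = (i != k).
  move=> zinj; rewrite horner_prod prodf_seq_eq0.
  apply/hasP/idP => [[j _ /andP[jk]]|ik].
    by rewrite hornerXsubC subr_eq0 (inj_eq zinj) => /eqP ->.
  by exists i; rewrite ?mem_index_enum// ik hornerXsubC subrr eqxx.
exists (map_poly polyC (l x q.1) * (l y q.2)%:P); split.
- exact: Qdeg_tensor.
- by rewrite /evq ev_tensor mulf_eq0 !lE ?eqxx//; exact: inj.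
- move=> q' qq'; apply/eqP; rewrite /evq ev_tensor mulf_eq0 !lE; try exact: inj.
  by move: qq'; rewrite -pair_eqE /= negb_and.
Qed.

(** [Vh] imposes no continuity between cells, so a nodal delta function extended by zero is
    admissible. It isolates one term of each sum, and the nonzero mass cancels. *)
Lemma nodal_eq (a b : cell M -> node p -> R) :
  q_increasing g -> (forall K q, mass g K q != 0) ->
  (forall v, Vh p v -> sumV g (fun K q => a K q * val_at g v K q)
                     = sumV g (fun K q => b K q * val_at g v K q)) ->
  forall K q, a K q = b K q.
Proof.
move=> ginc m0 ab K q; have [f [Qf fq0 f0]] := nodal_delta K q ginc.
pose v : bpoly M := fun K' => if K' == K then f else 0.
have /ab : Vh p v.
  by move=> K'; rewrite /v; case: ifP => // _; split;
    rewrite ?size_poly0// sizeYE rmorph0 size_poly0.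
have sumE c : sumV g (fun K q => c K q * val_at g v K q)
    = mass g K q * (c K q * evq g K f q).
  rewrite /sumV (bigD1 K)//= [X in _ + X]big1 ?addr0 => [|K' /negbTE KK'].
    rewrite (bigD1 q)//= big1 ?addr0 => [|q' qq']; first by rewrite /val_at /v eqxx.
    by rewrite /val_at /v eqxx f0// !mulr0.
  rewrite big1// => q' _; rewrite /val_at /v KK'.
  by rewrite /evq /ev !horner0 !mulr0.
by rewrite !sumE => /(mulfI (m0 _ _))/(mulIf fq0).
Qed.

(** * Nodal energies under linear combination, stage map and operator; entropy monotonicity *)

Lemma val_at_comb c1 c2 (Y1 Y2 : state M) K q :
  val_at g (se (comb c1 Y1 c2 Y2)) K q
  = c1 * val_at g (se Y1) K q + c2 * val_at g (se Y2) K q.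
Proof. by rewrite /val_at /evq /ev /= !hornerE. Qed.

(** The maxima in [lambda] and [sigma] start from 0, so they are nonnegative whatever values enter
    them. *)
Lemma Theta_ge0 rho rc l K (u B : vec3 (bpoly M)) : 0 <= Theta g rho rc l K u B.
Proof.
have max_ge0 (I : finType) (P : pred I) (F : I -> R) : 0 <= \big[Num.max/0]_(i | P i) F i.
  by elim/big_rec: _ => // i x _ x0; rewrite le_max x0 orbT.
rewrite /Theta; apply: sumr_ge0 => I _; apply: mulr_ge0.
  by rewrite mulr_ge0// divr_ge0// ltW// hsize_gt0.
by apply: sumr_ge0 => r _; exact: max_ge0.
Qed.

Lemma damp_itv rho rc sM tau l K (u B : vec3 (bpoly M)) : 0 <= sM -> 0 <= tau ->
  0 <= damp g rho rc sM tau l K u B <= 1.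
Proof.
move=> sM0 tau0; rewrite expR_ge0 -expR0 ler_expR oppr_le0.
by rewrite mulr_ge0// ?mulr_ge0// Theta_ge0.
Qed.

Lemma PM_rel_energy_le rho voe rc sM tau (Y Z : state M) : 0 <= sM -> 0 <= tau ->
  PM_rel g rho voe rc sM tau Y Z ->
  forall K q, val_at g (se Y) K q <= val_at g (se Z) K q.
Proof.
move=> sM0 tau0; case: voe => /= [|-> //].
move=> [P [_ _ [_ eZ] _]] K q; rewrite eZ lerDl mulr_ge0 ?invr_ge0//.
apply: sumr_ge0 => l _; rewrite mulr_ge0 ?sqr_ge0// subr_ge0.
by have /andP[D0 D1] := damp_itv rho rc l K (su Y) (sB Y) sM0 tau0; rewrite expr_le1.
Qed.

Lemma mass_gt0 K q : (1 <= p)%N -> gauss_lobatto g -> 0 < mass g K q.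
Proof.
move=> p1 gll; have w0 := gauss_lobatto_wgt_gt0 p1 gll.
by apply: mulr_gt0 => //; apply: mulr_gt0 => //; exact: jac_gt0.
Qed.

Lemma LM_rel_energy_ge0 m (gG : qrule R m.+1) (gL : qrule R m.+2) rho eta (Y Z : state M) :
  (1 <= p)%N -> gauss_lobatto g ->
  (forall K q, 0 < val_at g rho K q) -> (forall K q, 0 <= val_at g eta K q) ->
  LM_rel g gG gL rho eta Y Z ->
  forall K q, 0 <= val_at g (se Z) K q.
Proof.
move=> p1 gll rho0 eta0 [J [E [_ _ [_ eZ] _ _]]] K q.
have m0 K' q' : mass g K' q' != 0 by rewrite gt_eqF// mass_gt0.
have [ginc _ _ _] := gll.
(* Multiplying by the positive density produces the nodal coefficient on the left of the energy
   equation, which [nodal_eq] identifies with the Joule heating. *)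
rewrite -(pmulr_rge0 _ (rho0 K q)) (nodal_eq ginc m0 eZ).
by rewrite mulr_ge0// sqr_ge0.
Qed.

Lemma Eent_le gamma rho (e e' : bpoly M) :
  (1 <= p)%N -> gauss_lobatto g -> 1 < gamma ->
  (forall K q, 0 < val_at g rho K q) -> (forall K q, 0 < val_at g e K q) ->
  (forall K q, val_at g e K q <= val_at g e' K q) ->
  Eent g gamma rho e' <= Eent g gamma rho e.
Proof.
move=> p1 gll gamma1 rho0 e0 ee'.
have g0 : 0 < gamma - 1 by rewrite subr_gt0.
rewrite /Eent !mulNr lerN2 ler_pM2l ?invr_gt0//.
apply: ler_sum => K _; apply: ler_sum => q _.
rewrite ler_pM2l ?mass_gt0// ler_pM2l// lerD2r ler_ln ?posrE ?mulr_gt0//.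
  by rewrite ler_pM2l// mulr_gt0.
exact: lt_le_trans (ee' K q).
Qed.

End NodalValues.

Theorem mainTheorem7 (R : realType) (M : mesh R) (p m : nat) (gamma tau sM : R)
    (g : qrule R p.+1) (gG : qrule R m.+1) (gL : qrule R m.+2)
    (voe : bool) (rc : dir -> cell M -> bpoly M -> bool)
    (rho eta : bpoly M) (Y0 Y1 Y2 Y3 L0 L1 L2 : state M) :
  (1 <= p)%N -> m = p.-1 \/ m = p -> 1 < gamma -> 0 < tau -> 0 <= sM ->
  gauss_lobatto g -> gauss_legendre gG -> gauss_lobatto gL ->
  roundoff_test rc ->
  Vh p rho -> (forall K q, 0 < val_at g rho K q) ->
  Vh 0 eta -> (forall K z, cell_set K z -> 0 <= ev (eta K) z) ->
  Vh p (se Y0) -> Xh p (su Y0) -> Bh m (sB Y0) ->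
  (forall K q, 0 < val_at g (se Y0) K q) ->
  LM_rel g gG gL rho eta Y0 L0 ->
  PM_rel g rho voe rc sM tau (comb 1 Y0 tau L0) Y1 ->
  LM_rel g gG gL rho eta Y1 L1 ->
  PM_rel g rho voe rc sM tau (comb (3 / 4) Y0 (1 / 4) (comb 1 Y1 tau L1)) Y2 ->
  LM_rel g gG gL rho eta Y2 L2 ->
  PM_rel g rho voe rc sM tau (comb (1 / 3) Y0 (2 / 3) (comb 1 Y2 tau L2)) Y3 ->
  (forall K q,
     [/\ 0 < val_at g (se Y0) K q,
         val_at g (se Y0) K q <= val_at g (se Y1) K q,
         val_at g (se Y0) K q <= val_at g (se Y2) K q
       & val_at g (se Y0) K q <= val_at g (se Y3) K q])
  /\ Eent g gamma rho (se Y3) <= Eent g gamma rho (se Y0).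
Proof.
move=> p1 _ gamma1 tau0 sM0 gll _ _ _ _ rho0 eta_cst eta_cell _ _ _ e0.
move=> LM0 PM1 LM1 PM2 LM2 PM3.
(* Cells are half-open, so nodes on the upper or right edge lie outside [cell_set K]. As [eta] is
   constant on each cell, its value is read at the lower left corner, which belongs to the cell. *)
have eta0 K q : 0 <= val_at g eta K q.
  rewrite /val_at /evq (Qdeg0_ev _ (gx M K.1, gy M K.2) (eta_cst K)).
  by apply: eta_cell; split; rewrite /= lexx (gx_lt, gy_lt).
have tauL Y L K q : LM_rel g gG gL rho eta Y L -> 0 <= tau * val_at g (se L) K q.
  move=> LM; apply: mulr_ge0; first exact: ltW.
  exact: (LM_rel_energy_ge0 p1 gll rho0 eta0 LM).
have stage Y Z K q : PM_rel g rho voe rc sM tau Y Z -> 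
    val_at g (se Y) K q <= val_at g (se Z) K q.
  by move=> PM; apply: (PM_rel_energy_le sM0 (ltW tau0) PM).
have e1 K q : val_at g (se Y0) K q <= val_at g (se Y1) K q.
  have := stage _ _ K q PM1; have := tauL _ _ K q LM0; rewrite !val_at_comb; lra.
(* The weights 3/4 and 1/4 sum to 1, so the bound [e1] on the previous stage carries over; [e3]
   follows from [e2] in the same way with 1/3 and 2/3. *)
have e2 K q : val_at g (se Y0) K q <= val_at g (se Y2) K q.
  have := stage _ _ K q PM2; have := tauL _ _ K q LM1; have := e1 K q.
  by rewrite !val_at_comb; lra.
have e3 K q : val_at g (se Y0) K q <= val_at g (se Y3) K q.
  have := stage _ _ K q PM3; have := tauL _ _ K q LM2; have := e2 K q.
  by rewrite !val_at_comb; lra.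
by split => [K q|]; [split | exact: Eent_le].
Qed.
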